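(* Consider the linear impulsive differential equation on a fixed time interval $[0,T]$ with arrival rate $\lambda$, service rate $\mu$, proportional jump magnitude $b$ and initial value $q_0$, in which exactly one impulse is applied to the system, at time $\tau\in[0,T]$: $$\frac{dq}{dt}(t)=\lambda-\mu q(t)\quad (t\neq\tau),\qquad q(\tau^+)-q(\tau^-)=b\,q(\tau^-),\qquad q(0)=q_0.$$ Let $J(\tau)=\frac1T\int_0^T q(t)\,dt$ be the average queue length. Then the optimal time $\tau_U^*=\mathrm{argmax}_{\tau\in[0,T]}J(\tau)$ to apply the impulse so that the average queue length is maximized is $$\tau_U^*=T,$$ whereas the optimal time $\tau_L^*=\mathrm{argmin}_{\tau\in[0,T]}J(\tau)$ to apply the impulse so that the average queue length is minimized is $$\tau_L^*=\begin{cases}\dfrac T2+\dfrac{\ln\left(1-q_0\frac{\mu}{\lambda}\right)}{2\mu} & \text{when } q_0<\dfrac{\lambda}{\mu},\\[2mm] 0 & \text{otherwise.}\end{cases}$$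
   Context: $q(t)$ is the queue length at time $t$; $q(\tau^-)$ and $q(\tau^+)$ denote its values just before and just after the impulse. If $\tau=0$ the impulse is applied to the initial value $q_0$ (so $q(0^-)=q_0$ and $q(0^+)=(1+b)q_0$); if $\tau=T$ the impulse does not affect the integral.
   Formalization: Requires b<0 (for b>0 max and min swap; for b=0 J is constant); T is a maximizer for all q0≥0 but claimed unique only for q0>0 (at q0=0, τ=0 ties); where the printed τ_L* is negative, hence outside [0,T], the minimizer is 0 instead. *)

(* Defs.v *)
From Stdlib Require Import Reals.
From Coquelicot Require Import Coquelicot.
Open Scope R_scope.

(** [q] solves, on [0, T], the equation [q' = lam - mu * q] with initial value
    [q0] and exactly one impulse, at time [tau]; [qm] and [qp] are the values
    just before and just after it.  Away from [tau], [q] is continuous relative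
    to [0, T], so that [q 0 = q0] really is the initial condition of the
    differential equation when [tau <> 0].  If [tau = 0] the value before the
    impulse is [q0]; if [tau = T] the value after it lies beyond the horizon
    and does not constrain [q].  For [0 < tau] the value of [q] at [tau] itself
    is left free. *)
Definition impulsive_solution (lam mu b q0 T tau : R) (q : R -> R) : Prop :=
  q 0 = q0 /\
  (forall t, 0 <= t <= T -> t <> tau ->
     filterlim q (within (fun s => 0 <= s <= T) (locally t)) (locally (q t))) /\
  (forall t, 0 < t < T -> t <> tau -> is_derive q t (lam - mu * q t)) /\
  exists qm qp : R,
    (tau = 0 -> qm = q0) /\
    (0 < tau -> filterlim q (at_left tau) (locally qm)) /\
    (tau < T -> filterlim q (at_right tau) (locally qp)) /\
    qp - qm = b * qm.

Definition average (T : R) (f : R -> R) : R := 1 / T * RInt f 0 T.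

Definition is_argmax (D : R -> Prop) (f : R -> R) (x : R) : Prop :=
  D x /\ forall y, D y -> f y <= f x.

Definition is_argmin (D : R -> Prop) (f : R -> R) (x : R) : Prop :=
  D x /\ forall y, D y -> f x <= f y.

Definition tau_L (lam mu q0 T : R) : R :=
  if Rlt_dec q0 (lam / mu)
  then T / 2 + ln (1 - q0 * (mu / lam)) / (2 * mu)
  else 0.

(* Main.v *)
(** Write [c = lam / mu].  By variation of constants the impulse at [tau] adds
    [b q(tau-) exp (- mu (t - tau))] to the impulse-free solution for [t > tau],
    where [q(tau-) = c + (q0 - c) exp (- mu tau)].  Hence [T J(tau)] is the
    impulse-free integral plus [b / mu] times
    [g(tau) = q(tau-) (1 - exp (- mu (T - tau)))].  As [b < 0], maximizing [J]
    means minimizing [g >= 0], which vanishes at [tau = T]; minimizing [J] means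
    maximizing [g].  In the variable [X = exp (mu tau)], [g] is a constant minus
    [A X + k / X], with [A = c exp (- mu T)] and [k = c - q0], whose minimum
    over [X > 0] is at [X^2 = k / A] when [k > 0]. *)
Require Import Defs.
From Stdlib Require Import Reals Lra.
From Coquelicot Require Import Coquelicot.
Open Scope R_scope.

(** * Explicit solution and integral away from the impulse *)

(** The integrating factor makes [G] constant on the open interval. The initial value enters only as
    the right limit [l], since the function may jump at [x]. *)
Lemma linear_ode_solution (lam mu : R) (hmu : 0 < mu)
  (f : R -> R) (x y l : R) (hxy : x < y)
  (hf : forall t, x < t < y -> is_derive f t (lam - mu * f t))
  (hl : filterlim f (at_right x) (locally l)) (t : R) (ht : x < t < y) :
  f t = lam / mu + (l - lam / mu) * exp (- (mu * (t - x))).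
Proof.
set (G := fun s => (f s - lam / mu) * exp (mu * (s - x))).
assert (dG : forall s, x < s < y -> is_derive G s 0).
{ intros s hs; unfold G.
  auto_derive; [exists (lam - mu * f s); exact (hf s hs)|].
  replace (Derive (fun x0 => f x0) s) with (lam - mu * f s)
    by (symmetry; apply is_derive_unique; exact (hf s hs)).
  field; lra. }
assert (cG : forall s, x < s < y -> G s = G t).
{ intros s hs.
  destruct (MVT_gen G s t (fun _ => 0)) as [z [_ hz]].
  - intros r hr; apply dG; split.
    + revert hr; unfold Rmin; destruct Rle_dec; intros; lra.
    + revert hr; unfold Rmax; destruct Rle_dec; intros; lra.
  - intros r hr; apply continuity_pt_filterlim.
    apply (ex_derive_continuous G); exists 0; apply dG.
    revert hr; unfold Rmin, Rmax; destruct Rle_dec; intros; lra.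
  - lra. }
set (h := fun s => lam / mu + G t * exp (- (mu * (s - x)))).
assert (fh : forall s, x < s < y -> f s = h s).
{ intros s hs; unfold h; rewrite <- (cG s hs); unfold G.
  rewrite Rmult_assoc, <- exp_plus.
  replace (mu * (s - x) + - (mu * (s - x))) with 0 by ring.
  rewrite exp_0; ring. }
(* [h] is continuous at [x], so uniqueness of the right limit gives [l = h x], which fixes the
   constant [G t]. *)
assert (hh : filterlim f (at_right x) (locally (h x))).
{ apply filterlim_ext_loc with h.
  - exists (mkposreal (y - x) ltac:(lra)); intros s hs xs.
    symmetry; apply fh; split; [exact xs|].
    assert (bs := Rle_lt_trans _ _ _ (Rle_abs _) hs).
    change (s + - x < y - x) in bs; lra.
  - apply (filterlim_filter_le_1 (F := locally x)).
    + apply filter_le_within.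
    + apply (ex_derive_continuous h); unfold h; auto_derive; trivial. }
assert (lh := filterlim_locally_unique _ _ _ hl hh).
rewrite (fh t ht), lh; unfold h.
replace (mu * (x - x)) with 0 by ring.
rewrite Ropp_0, exp_0; ring.
Qed.

(** The formula is required on the open interval only: endpoint values, such as the one at an
    impulse, do not affect the integral. *)
Lemma is_RInt_relaxation (lam mu : R) (hmu : 0 < mu)
  (f : R -> R) (x y K : R) (hxy : x <= y)
  (hf : forall t, x < t < y -> f t = lam / mu + K * exp (- (mu * (t - x)))) :
  is_RInt f x y (lam / mu * (y - x) + K / mu * (1 - exp (- (mu * (y - x))))).
Proof.
set (F := fun t => lam / mu * (t - x) - K / mu * exp (- (mu * (t - x)))).
apply is_RInt_ext with (fun t => lam / mu + K * exp (- (mu * (t - x)))).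
{ rewrite Rmin_left, Rmax_right by lra; intros t ht; symmetry; auto. }
replace (_ + _) with (minus (F y) (F x)).
- apply (is_RInt_derive F).
  + intros t _; unfold F; auto_derive; [trivial | unfold Rminus; field; lra].
  + intros t _.
    apply (ex_derive_continuous
             (fun s => lam / mu + K * exp (- (mu * (s - x))))).
    auto_derive; trivial.
- unfold F, minus, plus, opp; simpl.
  replace (mu * (x - x)) with 0 by ring.
  rewrite Ropp_0, exp_0; ring.
Qed.

(** * The average as a function of the impulse time *)

(** The function g above: the first factor is q(tau-), the second is [mu] times the integral of exp
    (- mu (t - tau)) over [tau, T]. *)
Definition impulse_gain (lam mu q0 T tau : R) : R :=
  (lam / mu + (q0 - lam / mu) * exp (- (mu * tau))) *
  (1 - exp (- (mu * (T - tau)))).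

Lemma average_impulsive_solution (lam mu b q0 T tau : R) (q : R -> R)
  (hmu : 0 < mu) (hT : 0 < T) (htau : 0 <= tau <= T)
  (hq : impulsive_solution lam mu b q0 T tau q) :
  average T q =
  1 / T * (lam / mu * T + (q0 - lam / mu) / mu * (1 - exp (- (mu * T)))
           + b / mu * impulse_gain lam mu q0 T tau).
Proof.
destruct hq as [qz [qc [qd [qm [qp [m0 [ml [pr jump]]]]]]]].
assert (before : forall t, 0 < t < tau ->
    q t = lam / mu + (q0 - lam / mu) * exp (- (mu * (t - 0)))).
{ intros t ht; apply (linear_ode_solution lam mu hmu q 0 tau); try lra.
  - intros s hs; apply qd; lra.
  - rewrite <- qz.
    apply filterlim_filter_le_1 with (2 := qc 0 ltac:(lra) ltac:(lra)).
    intros P [e he].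
    (* The bound [T] keeps the right neighbourhood inside [0, T], where continuity at 0 is given. *)
    exists (mkposreal (Rmin e T) (Rmin_stable_in_posreal e (mkposreal T hT))).
    intros s hs s0; apply he.
    + apply ball_le with (2 := hs); apply Rmin_l.
    + assert (bs := Rle_lt_trans _ _ _ (Rle_abs _) hs).
      assert (bT := Rmin_r e T).
      change (s + - 0 < Rmin e T) in bs; lra. }
assert (qmE : qm = lam / mu + (q0 - lam / mu) * exp (- (mu * tau))).
{ destruct (Req_dec tau 0) as [t0|t0].
  - rewrite (m0 t0), t0, Rmult_0_r, Ropp_0, exp_0; ring.
  - set (h := fun s => lam / mu + (q0 - lam / mu) * exp (- (mu * (s - 0)))).
    replace (mu * tau) with (mu * (tau - 0)) by ring.
    apply (filterlim_locally_unique q) with (1 := ml ltac:(lra)).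
    change (filterlim q (at_left tau) (locally (h tau))).
    apply filterlim_ext_loc with h.
    + exists (mkposreal tau ltac:(lra)); intros s hs st.
      symmetry; apply before; split; [|exact st].
      assert (bs := Rle_lt_trans _ _ _ (Rle_abs _) (ball_sym _ _ _ hs)).
      change (tau + - s < tau) in bs; lra.
    + apply (filterlim_filter_le_1 (F := locally tau)).
      * apply filter_le_within.
      * apply (ex_derive_continuous h); unfold h; auto_derive; trivial. }
assert (after : forall t, tau < t < T ->
    q t = lam / mu + (qp - lam / mu) * exp (- (mu * (t - tau)))).
{ intros t ht; apply (linear_ode_solution lam mu hmu q tau T); try lra.
  - intros s hs; apply qd; lra.
  - apply pr; lra. }
assert (I := is_RInt_Chasles q _ _ _ _ _
  (is_RInt_relaxation lam mu hmu q 0 tau _ (proj1 htau) before)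
  (is_RInt_relaxation lam mu hmu q tau T _ (proj2 htau) after)).
unfold average; rewrite (is_RInt_unique _ _ _ _ I).
replace qp with ((1 + b) * qm) by lra.
unfold plus, impulse_gain; simpl; rewrite qmE.
(* Everything becomes rational in the exponentials for the two subintervals. *)
replace (- (mu * T)) with (- (mu * tau) + - (mu * (T - tau))) by ring.
rewrite exp_plus, Rminus_0_r.
field; lra.
Qed.

(** * Maximizing the gain *)

(** With X = exp (mu x) and Y = exp (mu y) the right side is (Y - X) (A - k / (X Y)); its sign is
    read off without derivatives. *)
Lemma impulse_gain_sub (lam mu q0 T x y : R) :
  impulse_gain lam mu q0 T x - impulse_gain lam mu q0 T y =
  (exp (mu * y) - exp (mu * x)) *
  (lam / mu * exp (- (mu * T))
   - (lam / mu - q0) * exp (- (mu * x)) * exp (- (mu * y))).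
Proof.
assert (tail : forall z,
  exp (- (mu * (T - z))) = exp (- (mu * T)) * exp (mu * z)).
{ intros z; rewrite <- exp_plus; f_equal; ring. }
unfold impulse_gain; rewrite !tail, !exp_Ropp.
assert (hx := exp_pos (mu * x)); assert (hy := exp_pos (mu * y)).
assert (hT := exp_pos (mu * T)).
generalize (lam / mu); intros c; field; lra.
Qed.

(** [hx] says X^2 = k / A, which turns the difference into A (Y - X)^2 / Y. *)
Lemma impulse_gain_max_interior (lam mu q0 T x y : R)
  (hlam : 0 < lam) (hmu : 0 < mu)
  (hx : lam / mu - q0 = lam / mu * exp (- (mu * T)) * exp (2 * (mu * x)))
  (hyx : y <> x) :
  impulse_gain lam mu q0 T y < impulse_gain lam mu q0 T x.
Proof.
apply Rlt_0_minus; rewrite impulse_gain_sub, hx.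
assert (hc := Rdiv_lt_0_compat _ _ hlam hmu).
assert (X0 := exp_pos (mu * x)); assert (Y0 := exp_pos (mu * y)).
assert (hA := Rmult_lt_0_compat _ _ hc (exp_pos (- (mu * T)))).
revert hA; generalize (lam / mu * exp (- (mu * T))); intros A hA.
rewrite !exp_Ropp.
replace (exp (2 * (mu * x))) with (exp (mu * x) * exp (mu * x))
  by (rewrite <- exp_plus; f_equal; ring).
assert (XY : exp (mu * y) - exp (mu * x) <> 0).
{ intros e; apply hyx, (Rmult_eq_reg_l mu); [apply exp_inv|]; lra. }
revert X0 Y0 XY; generalize (exp (mu * x)), (exp (mu * y)); intros X Y X0 Y0 XY.
replace (_ * _) with (A * Rsqr (Y - X) / Y) by (unfold Rsqr; field; lra).
apply Rdiv_lt_0_compat, Y0.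
apply Rmult_lt_0_compat; [exact hA | apply Rsqr_pos_lt, XY].
Qed.

(** Here X = 1; Y > 1 and k <= A make both Y - 1 and A - k / Y positive. *)
Lemma impulse_gain_max_0 (lam mu q0 T y : R)
  (hlam : 0 < lam) (hmu : 0 < mu)
  (hk : lam / mu - q0 <= lam / mu * exp (- (mu * T)))
  (hy : 0 < y) :
  impulse_gain lam mu q0 T y < impulse_gain lam mu q0 T 0.
Proof.
apply Rlt_0_minus; rewrite impulse_gain_sub.
assert (hc := Rdiv_lt_0_compat _ _ hlam hmu).
assert (hA := Rmult_lt_0_compat _ _ hc (exp_pos (- (mu * T)))).
assert (hmy := Rmult_lt_0_compat _ _ hmu hy).
rewrite Rmult_0_r, Ropp_0, exp_0, Rmult_1_r.
apply Rmult_lt_0_compat.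
- assert (h := exp_increasing 0 (mu * y) hmy); rewrite exp_0 in h; lra.
- assert (h := exp_increasing (- (mu * y)) 0 ltac:(lra)); rewrite exp_0 in h.
  assert (h0 := exp_pos (- (mu * y))).
  apply Rmult_le_compat_r with (r := exp (- (mu * y))) in hk; [nra | lra].
Qed.

(** q(tau-) is a convex combination of c > 0 and q0 >= 0, with weight exp (- mu tau) on q0. *)
Lemma impulse_gain_pos (lam mu q0 T tau : R)
  (hlam : 0 < lam) (hmu : 0 < mu) (hq0 : 0 <= q0) (htau : 0 <= tau < T)
  (h0 : 0 < q0 \/ 0 < tau) :
  0 < impulse_gain lam mu q0 T tau.
Proof.
assert (hc := Rdiv_lt_0_compat _ _ hlam hmu).
assert (hE := exp_pos (- (mu * tau))).
apply Rmult_lt_0_compat.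
- destruct (Req_dec tau 0) as [e|n].
  + rewrite e, Rmult_0_r, Ropp_0, exp_0; lra.
  + assert (hE1 := exp_increasing (- (mu * tau)) 0 ltac:(nra)).
    rewrite exp_0 in hE1; nra.
- assert (h := exp_increasing (- (mu * (T - tau))) 0 ltac:(nra)).
  rewrite exp_0 in h; lra.
Qed.

(** * The optimal times *)

Lemma is_argmin_unique_iff (D : R -> Prop) (f : R -> R) (x : R)
  (Dx : D x) (hx : forall y, D y -> y <> x -> f x < f y) (z : R) :
  is_argmin D f z <-> z = x.
Proof.
split.
- intros [Dz hz]; destruct (Req_dec z x) as [|n]; [assumption|].
  specialize (hx z Dz n); specialize (hz x Dx); lra.
- intros ->; split; [exact Dx|]; intros y Dy.
  destruct (Req_dec y x) as [->|n]; [apply Rle_refl | apply Rlt_le; auto].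
Qed.

(** For [q0 = 0] an impulse at time 0 has no effect and ties with one at [T], hence [0 < q0] for
    uniqueness. A negative [tau_L] is a critical point before the interval, and the minimizer is
    then 0. *)
Theorem theorem4p1 (lam mu b q0 T : R) (q : R -> R -> R)
  (hlam : 0 < lam) (hmu : 0 < mu) (hb : b < 0) (hq0 : 0 <= q0) (hT : 0 < T)
  (hq : forall tau, 0 <= tau <= T -> impulsive_solution lam mu b q0 T tau (q tau)) :
  let D := fun tau => 0 <= tau <= T in
  let J := fun tau => average T (q tau) in
  (is_argmax D J T /\
   (0 < q0 -> forall tau, is_argmax D J tau <-> tau = T)) /\
  (0 <= tau_L lam mu q0 T ->
   forall tau, is_argmin D J tau <-> tau = tau_L lam mu q0 T) /\
  (tau_L lam mu q0 T < 0 ->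
   forall tau, is_argmin D J tau <-> tau = 0).
Proof.
intros D J.
set (g := impulse_gain lam mu q0 T).
(* The factor [b / mu] is negative, so J reverses the order of g. *)
assert (Jlt : forall x y, D x -> D y -> g y < g x -> J x < J y).
{ intros x y Dx Dy hg; unfold J.
  rewrite (average_impulsive_solution lam mu b q0 T x) by auto.
  rewrite (average_impulsive_solution lam mu b q0 T y) by auto.
  apply Rmult_lt_compat_l; [apply Rdiv_lt_0_compat; lra|].
  apply Rplus_lt_compat_l.
  assert (hbm : 0 < - b / mu) by (apply Rdiv_lt_0_compat; lra).
  apply Rmult_lt_compat_l with (r := - b / mu) in hg; [|exact hbm].
  fold g; unfold Rdiv in *; lra. }
assert (DT : D T) by (unfold D; lra).
assert (D0 : D 0) by (unfold D; lra).
assert (gT : g T = 0).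
{ unfold g, impulse_gain; rewrite Rminus_diag, Rmult_0_r, Ropp_0, exp_0; ring. }
assert (Jmax : forall y, D y -> y <> T -> 0 < q0 \/ 0 < y -> J y < J T).
{ intros y Dy n h; apply Jlt; auto; rewrite gT.
  apply impulse_gain_pos; auto; unfold D in Dy; lra. }
assert (aT : is_argmax D J T).
{ split; [exact DT|]; intros y Dy.
  destruct (Req_dec y T) as [->|n]; [apply Rle_refl|].
  destruct (Req_dec y 0) as [->|n0];
    [|apply Rlt_le, Jmax; auto; unfold D in Dy; lra].
  destruct (Req_dec q0 0) as [z|nz]; [|apply Rlt_le, Jmax; auto; lra].
  unfold J; rewrite (average_impulsive_solution lam mu b q0 T 0) by auto.
  rewrite (average_impulsive_solution lam mu b q0 T T) by auto.
  fold g; rewrite gT; apply Req_le; do 3 f_equal.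
  unfold g, impulse_gain; rewrite z, (Rmult_0_r mu), Ropp_0, exp_0; ring. }
assert (hmin0 : lam / mu - q0 <= lam / mu * exp (- (mu * T)) ->
                forall tau, is_argmin D J tau <-> tau = 0).
{ intros hk; apply is_argmin_unique_iff; [exact D0|].
  intros y Dy n; apply Jlt; auto.
  apply impulse_gain_max_0; auto; unfold D in Dy; lra. }
assert (hc := Rdiv_lt_0_compat _ _ hlam hmu).
assert (hA := Rmult_lt_0_compat _ _ hc (exp_pos (- (mu * T)))).
split; [split; [exact aT|]|].
{ intros q0_gt0 tau; split; [|intros ->; exact aT].
  intros [Dt ht]; destruct (Req_dec tau T) as [|n]; [assumption|].
  assert (h1 := Jmax tau Dt n (or_introl q0_gt0)); specialize (ht T DT); lra. }
(* If q0 >= c then k <= 0 < A and [hmin0] applies. *)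
unfold tau_L; destruct (Rlt_dec q0 (lam / mu)) as [lt|ge];
  [|split; intros h; [apply hmin0 | exfalso]; lra].
set (x := T / 2 + ln (1 - q0 * (mu / lam)) / (2 * mu)).
assert (r0 : 0 < 1 - q0 * (mu / lam)).
{ replace (1 - q0 * (mu / lam)) with ((lam / mu - q0) * (mu / lam))
    by (field; lra).
  apply Rmult_lt_0_compat; [lra | apply Rdiv_lt_0_compat; lra]. }
(* The formula for [x] solves X^2 = k / A. *)
assert (hx : lam / mu - q0 = lam / mu * exp (- (mu * T)) * exp (2 * (mu * x))).
{ replace (2 * (mu * x)) with (mu * T + ln (1 - q0 * (mu / lam)))
    by (unfold x; field; lra).
  rewrite exp_plus, exp_ln by exact r0.
  assert (hE := exp_pos (mu * T)).
  rewrite exp_Ropp; field; lra. }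
split; intros sx.
- assert (Dx : D x).
  { split; [exact sx|].
    (* Since q0 >= 0 the logarithm is nonpositive, so x <= T / 2. *)
    assert (hl : ln (1 - q0 * (mu / lam)) <= 0).
    { rewrite <- ln_1; apply ln_le; [exact r0|].
      assert (0 < mu / lam) by (apply Rdiv_lt_0_compat; lra); nra. }
    apply Rmult_le_compat_r with (r := / (2 * mu)) in hl;
      [|apply Rlt_le, Rinv_0_lt_compat; lra].
    unfold x, Rdiv in *; lra. }
  apply is_argmin_unique_iff; [exact Dx|].
  intros y Dy n; apply Jlt; auto.
  apply impulse_gain_max_interior; auto.
(* x < 0 gives k = A exp (2 mu x) < A. *)
- apply hmin0; rewrite hx.
  assert (h := exp_increasing (2 * (mu * x)) 0 ltac:(nra)).
  rewrite exp_0 in h; nra.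
Qed.
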